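(* Let $K$ be a field which is complete with respect to a nontrivial, non-Archimedean absolute value $|\cdot|$ and which has a discrete value group $|K^\times|$, and let $\pi$ be a uniformizing parameter of $K$. Let $n$ be a positive integer, and let $A$ be an $n\times n$ matrix over $K$ with all entries in the disc $D(1,|\pi|^\ell)$ for a positive integer $\ell>2\,\mathrm{ord}_\pi(n)$. Then the following conditions hold. (a) $A$ has a simple eigenvalue $\lambda_{\max}\in K$ such that $|\lambda|<|\lambda_{\max}|$ for all other eigenvalues $\lambda\in\mathbb{C}_K$ of $A$. Moreover, $|\lambda_{\max}|=|n|$. (b) The maximal eigenvalue $\lambda_{\max}$ is an element of the disc $D(n,|\pi|^\ell/|n|)$. (c) There exists a $\lambda_{\max}$-eigenvector $\mathbf{x}$ of $A$, all of whose components are elements of the disc $D(1,|\pi|^\ell/|n|)$. (d) The limit $P_A=\lim_{k\to+\infty}\left(\frac{1}{\lambda_{\max}}A\right)^k$ exists and $P_A$ is a projection operator onto the $\lambda_{\max}$-eigenspace of $A$.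
   Context: $R=\{x\in K : |x|\leq 1\}$ is the ring of integers of $K$; a uniformizing parameter $\pi$ is an element of $R$ such that $\pi R$ is the unique maximal ideal of $R$ (equivalently $|\pi|=\max\{|x| : x\in R, |x|<1\}$). $\mathrm{ord}_\pi$ is the discrete valuation on $K$ normalized so that $|x|=|\pi|^{\mathrm{ord}_\pi(x)}$, with $\mathrm{ord}_\pi(\pi)=1$ and $\mathrm{ord}_\pi(0)=+\infty$; the integer $n$ is regarded as an element of $K$ in $|n|$ and $\mathrm{ord}_\pi(n)$ (so the hypothesis $\ell>2\,\mathrm{ord}_\pi(n)$ forces $n\neq 0$ in $K$). For $c\in K$ and real $r\geq 0$, $D(c,r)=\{x\in K : |x-c|\leq r\}$. $\mathbb{C}_K$ is the completion of the algebraic closure of $K$, with $|\cdot|$ extended (uniquely) to it. A simple eigenvalue is one of multiplicity one as a root of the characteristic polynomial. Limits of matrices are taken with respect to the norm $\|(a_{ij})\|=\max|a_{ij}|$, i.e. entrywise. *)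

(* Defs.v *)
From HB Require Import structures.
From mathcomp Require Import all_boot all_order all_algebra.
From mathcomp Require Import all_classical all_reals all_analysis.
Set Implicit Arguments.
Unset Strict Implicit.
Unset Printing Implicit Defensive.
Import Order.TTheory GRing.Theory Num.Theory.
Import numFieldNormedType.Exports.
Local Open Scope classical_set_scope.
Local Open Scope ring_scope.

Record nonarch_abs (R : realType) (K : fieldType) (v : K -> R) : Prop := {
  nonarch_abs_ge0 : forall x, 0 <= v x;
  nonarch_abs_eq0 : forall x, v x = 0 <-> x = 0;
  nonarch_absM : forall x y, v (x * y) = v x * v y;
  nonarch_absD : forall x y, v (x + y) <= Num.max (v x) (v y) }.

Definition nontrivial_abs (R : realType) (K : fieldType) (v : K -> R) : Prop :=
  exists2 x : K, x != 0 & v x != 1.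

Definition value_group (R : realType) (K : fieldType) (v : K -> R) : set R :=
  v @` [set x | x != 0].

(* The subspace topology on |K^*| is discrete. *)
Definition discrete_value_group (R : realType) (K : fieldType) (v : K -> R) :
    Prop :=
  value_group v `<=` isolated (value_group v).

Definition abs_cauchy (R : realType) (K : fieldType) (v : K -> R)
    (u : nat -> K) : Prop :=
  forall e : R, 0 < e ->
    exists N : nat, forall p q : nat, (N <= p)%N -> (N <= q)%N ->
      v (u p - u q) < e.

Definition abs_complete (R : realType) (K : fieldType) (v : K -> R) : Prop :=
  forall u : nat -> K, abs_cauchy v u ->
    exists a : K, (fun k => v (u k - a)) @ \oo --> (0 : R).

Definition disc (R : realType) (K : fieldType) (v : K -> R) (c : K) (r : R) :
    set K :=
  [set x | v (x - c) <= r].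

Definition int_ring (R : realType) (K : fieldType) (v : K -> R) : set K :=
  [set x | v x <= 1].

Definition int_ideal (R : realType) (K : fieldType) (v : K -> R) (I : set K) :
    Prop :=
  [/\ I `<=` int_ring v, I 0,
      forall x y, I x -> I y -> I (x + y)
    & forall a x, int_ring v a -> I x -> I (a * x)].

Definition maximal_int_ideal (R : realType) (K : fieldType) (v : K -> R)
    (I : set K) : Prop :=
  [/\ int_ideal v I, I <> int_ring v
    & forall J, int_ideal v J -> I `<=` J -> J = I \/ J = int_ring v].

Definition uniformizer (R : realType) (K : fieldType) (v : K -> R) (pi : K) :
    Prop :=
  int_ring v pi /\
  forall I : set K,
    maximal_int_ideal v I <-> I = [set pi * a | a in int_ring v].

(* When pi is a uniformizer and the value group is discrete, a nonzero x has
   exactly one integer m with |x| = |pi| ^ m, so the default 0 of xget is not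
   used. *)
Definition ord_unif (R : realType) (K : fieldType) (v : K -> R) (pi x : K) :
    \bar int :=
  if x == 0 then +oo%E else (xget 0 [set m : int | v x = v pi ^ m])%:E.

(* A completion of an algebraic closure of K, with an extension of the absolute
   value of K; the extension is unique, and so is the whole structure up to an
   isometric isomorphism over K. *)
Record completed_alg_closure (R : realType) (K : fieldType) (v : K -> R) := {
  cac_closure : closedFieldType;
  cac_field : fieldType;
  cac_inj0 : {rmorphism K -> cac_closure};
  cac_inj1 : {rmorphism cac_closure -> cac_field};
  cac_abs : cac_field -> R;
  cac_algebraic : forall x : cac_closure, algebraicOver cac_inj0 x;
  cac_nonarch : nonarch_abs cac_abs;
  cac_extends : forall x : K, cac_abs (cac_inj1 (cac_inj0 x)) = v x;
  cac_complete : abs_complete cac_abs;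
  cac_dense : forall (x : cac_field) (e : R), 0 < e ->
    exists y : cac_closure, cac_abs (x - cac_inj1 y) < e }.

Definition cac_emb (R : realType) (K : fieldType) (v : K -> R)
    (C : completed_alg_closure v) (x : K) : cac_field C :=
  cac_inj1 C (cac_inj0 C x).

Definition simple_eigenvalue (K : fieldType) (n : nat) (A : 'M[K]_n) (a : K) :
    Prop :=
  eigenvalue A a /\ mup a (char_poly A) = 1%N.

(* MathComp's eigenspace consists of row vectors; here matrices act on column
   vectors. *)
Definition col_eigenspace (K : fieldType) (n : nat) (A : 'M[K]_n) (a : K) :
    set 'cV[K]_n :=
  [set x | A *m x = a *: x].

Definition mxnorm (R : realType) (K : fieldType) (v : K -> R) (m n : nat)
    (M : 'M[K]_(m, n)) : R :=
  \big[Num.max/0]_(i < m) \big[Num.max/0]_(j < n) v (M i j).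

Definition mx_cvg (R : realType) (K : fieldType) (v : K -> R) (m n : nat)
    (M : nat -> 'M[K]_(m, n)) (P : 'M[K]_(m, n)) : Prop :=
  (fun k => mxnorm v (M k - P)) @ \oo --> (0 : R).

Definition projection_onto (K : fieldType) (n : nat) (P : 'M[K]_n)
    (E : set 'cV[K]_n) : Prop :=
  P *m P = P /\ [set P *m x | x in [set: 'cV[K]_n]] = E.

(* Main.v *)
(** Write [q = |n|], [d = |pi|^l / q], so that [d < q] and [A] is within
    [d q <= d] of the all-ones matrix [J].  The sum of entries [s(x)] of a vector [x]
    satisfies [J x = s(x) 1], so, when [s(x) <> 0], [A x = s(x) x] means that
    [x] is fixed by [x |-> 1 + (A - J) x / s(x)]; this map preserves the
    ball of radius [d] around [1] and contracts it by [d / q].  This gives a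
    right eigenvector [x], and a left eigenvector [w] by transposition, for the
    same eigenvalue [a] with [|a| = q] because [|w x| = q].  If [u x = 0], then
    [u J = - u (x - 1) 1^T], so [|u A| <= d |u|]: any eigenvalue other than [a]
    has absolute value at most [d < q], and the powers of [A / a] tend to
    [P = x w / (w x)] since [(1 - P) x = 0].  Simplicity of [a] follows from
    [char_poly (A - a P) ('X - a) = char_poly A 'X], as [a] is not an eigenvalue
    of [A - a P]. *)
Require Import Defs.
From HB Require Import structures.
From mathcomp Require Import all_boot all_order all_algebra.
From mathcomp Require Import all_classical all_reals all_analysis.
From mathcomp Require Import ring.
Set Implicit Arguments.
Unset Strict Implicit.
Unset Printing Implicit Defensive.
Import Order.TTheory GRing.Theory Num.Theory.
Import numFieldNormedType.Exports.
Local Open Scope classical_set_scope.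
Local Open Scope ring_scope.

(** * Characteristic polynomials and rank-one deflation *)

(** The block matrices [[X, M; N, 1]] and [[1, 0; -N, X]] have block upper triangular products in
    both orders; the two determinants agree and give the two sides. *)
Lemma char_poly_mulC (F : fieldType) (m n : nat) (M : 'M[F]_(m, n))
    (N : 'M[F]_(n, m)) :
  'X ^+ n * char_poly (M *m N) = 'X ^+ m * char_poly (N *m M).
Proof.
pose M' := map_mx polyC M; pose N' := map_mx polyC N.
pose S := block_mx 'X%:M M' N' (1%:M : 'M[{poly F}]_n).
pose U := block_mx (1%:M : 'M[{poly F}]_m) 0 (- N') ('X%:M : 'M[{poly F}]_n).
have SU : \det (S *m U) = char_poly (M *m N) * 'X ^+ n.
  rewrite mulmx_block !mulmx1 !mulmx0 mul1mx mul1mx mulmxN subrr add0r add0r.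
  by rewrite det_ublock det_scalar /char_poly /char_poly_mx map_mxM.
have US : \det (U *m S) = 'X ^+ m * char_poly (N *m M).
  rewrite mulmx_block !mul1mx !mul0mx !addr0 mulmx1 mulNmx mulNmx.
  rewrite mul_mx_scalar mul_scalar_mx addNr det_ublock det_scalar.
  by rewrite addrC /char_poly /char_poly_mx map_mxM.
by rewrite mulrC -SU -US !det_mulmx mulrC.
Qed.

Section Deflation.
Variables (F : fieldType) (n : nat) (A : 'M[F]_n) (a : F).
Variables (x : 'cV[F]_n) (w : 'rV[F]_n).
Hypotheses (Ax : A *m x = a *: x) (wA : w *m A = a *: w).
Hypothesis wx_neq0 : (w *m x) 0 0 != 0.

(** When [w x <> 0], this is the projection onto the line of [x] along the kernel of [w]. *)
Definition eigenprojection : 'M[F]_n := ((w *m x) 0 0)^-1 *: (x *m w).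
Local Notation P := eigenprojection.

Lemma eigenprojection_mulr m (y : 'M[F]_(n, m)) :
  P *m y = ((w *m x) 0 0)^-1 *: (x *m (w *m y)).
Proof. by rewrite -scalemxAl mulmxA. Qed.

Lemma eigenprojection_eigenvector : P *m x = x.
Proof.
rewrite eigenprojection_mulr [w *m x]mx11_scalar mul_mx_scalar scalerA.
by rewrite mxE eqxx mulr1n mulVf ?scale1r.
Qed.

Lemma eigenvector_eigenprojection : w *m P = w.
Proof.
rewrite -scalemxAr mulmxA [w *m x]mx11_scalar mul_scalar_mx scalerA.
by rewrite mxE eqxx mulr1n mulVf ?scale1r.
Qed.

Lemma eigenprojection_idem : P *m P = P.
Proof.
by rewrite {2}/P -scalemxAr mulmxA eigenprojection_eigenvector.
Qed.

Lemma eigenprojectionA : P *m A = a *: P.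
Proof. by rewrite -scalemxAl -mulmxA wA -scalemxAr !scalerA mulrC. Qed.

Lemma mulA_eigenprojection : A *m P = a *: P.
Proof. by rewrite -scalemxAr mulmxA Ax -scalemxAl !scalerA mulrC. Qed.

(* With [B = A - a P], [('X - B)('X - a P) = 'X ('X - A)] because [B P = 0]. *)
Lemma char_poly_deflation :
  char_poly (A - a *: P) * ('X - a%:P) = char_poly A * 'X.
Proof.
have BP : (A - a *: P) *m (a *: P) = 0.
  rewrite -scalemxAr mulmxBl mulA_eigenprojection -scalemxAl.
  by rewrite eigenprojection_idem subrr scaler0.
have detB : char_poly (A - a *: P) * char_poly (a *: P) = 'X ^+ n * char_poly A.
  rewrite /char_poly -det_mulmx -[in RHS](det_scalar n) -det_mulmx.
  congr (\det _); rewrite /char_poly_mx mulmxBr !mulmxBl -map_mxM BP map_mx0.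
  rewrite subr0 -scalar_mxM mul_mx_scalar mul_scalar_mx mulmxBr -scalar_mxM.
  by rewrite mul_scalar_mx map_mxB scalerBr opprB addrA addrAC addrK.
(* [a P] is a column times a row, so its characteristic polynomial reduces to that of the 1 x 1
   matrix with entry [a]. *)
have charP : 'X * char_poly (a *: P) = 'X ^+ n * ('X - a%:P).
  have -> : a *: P = (a / (w *m x) 0 0 *: x) *m w.
    by rewrite -scalemxAl scalerA.
  rewrite -['X]expr1 char_poly_mulC -scalemxAr [w *m x]mx11_scalar.
  rewrite scale_scalar_mx [in X in _ / X]mxE eqxx mulr1n divfK//.
  by rewrite /char_poly det_mx11 !mxE !mulr1n.
have Xn0 : 'X ^+ n != 0 :> {poly F} by rewrite expf_neq0 ?polyX_eq0.
apply: (mulfI Xn0); rewrite mulrCA -charP mulrCA detB.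
by rewrite mulrCA (mulrC 'X).
Qed.

(** As [a <> 0], the factor ['X] in the deflation identity does not affect the multiplicity, so it
    remains to see that [a] is no root of [char_poly (A - a *: P)]. A row [u] with
    [u (A - a P) = a u] has [u P = 0], since [(A - a P) P = 0]; hence [u x = u P x = 0] and
    [u A = a u]. *)
Lemma mup_char_poly_deflation : a != 0 ->
    (forall u : 'rV[F]_n, u *m x = 0 -> u *m A = a *: u -> u = 0) ->
  mup a (char_poly A) = 1%N.
Proof.
move=> a0 no_eigen.
have nrootX : ~~ root 'X a by rewrite rootX.
have nrootB : ~~ root (char_poly (A - a *: P)) a.
  rewrite -eigenvalue_root_char; apply/eigenvalueP => -[u uB]; apply/negP/negPn.
  have uP : u *m P = 0.
    have : a *: (u *m P) = 0.
      rewrite scalemxAl -uB -mulmxA mulmxBl mulA_eigenprojection -scalemxAl.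
      by rewrite eigenprojection_idem subrr mulmx0.
    by move/eqP; rewrite scaler_eq0 (negPf a0) => /eqP.
  apply/eqP/no_eigen.
    by rewrite -eigenprojection_eigenvector mulmxA uP mul0mx.
  by move: uB; rewrite mulmxBr -scalemxAr uP scaler0 subr0.
rewrite -(mupMl _ nrootX) -char_poly_deflation mupMr//.
by rewrite -['X - _]expr1 mup_XsubCX eqxx.
Qed.

End Deflation.

(** * Geometric decay and non-Archimedean absolute values *)

Lemma exists_geometric_lt (R : realType) (c r e : R) : 0 <= r < 1 -> 0 < e ->
  exists N : nat, c * r ^+ N < e.
Proof.
move=> /andP[r0 r1] e0; have : c * r ^+ k @[k --> \oo] --> c * 0.
  by apply: cvgM (cvg_cst _) (cvg_expr _); rewrite ger0_norm.
rewrite mulr0 => /cvgr0Pnorm_lt /(_ e e0) [N _ /(_ N (leqnn N))] /= crN.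
by exists N; exact: le_lt_trans (ler_norm _) crN.
Qed.

Section NonarchAbs.
Variables (R : realType) (K : fieldType) (v : K -> R).
Hypothesis v_abs : nonarch_abs v.

Lemma nonarch_abs0 : v 0 = 0.
Proof. exact/(nonarch_abs_eq0 v_abs). Qed.

Lemma nonarch_abs_gt0 x : (0 < v x) = (x != 0).
Proof.
rewrite lt_neqAle (nonarch_abs_ge0 v_abs) andbT eq_sym; congr (~~ _).
by apply/eqP/eqP => /(nonarch_abs_eq0 v_abs).
Qed.

Lemma nonarch_abs1 : v 1 = 1.
Proof.
have v1_neq0 : v 1 != 0 by rewrite gt_eqF // nonarch_abs_gt0 oner_neq0.
by apply: (mulfI v1_neq0); rewrite -(nonarch_absM v_abs) !mulr1.
Qed.

Lemma nonarch_absX x k : v (x ^+ k) = v x ^+ k.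
Proof.
elim: k => [|k IHk]; first by rewrite !expr0 nonarch_abs1.
by rewrite !exprS (nonarch_absM v_abs) IHk.
Qed.

Lemma nonarch_absV x : v x^-1 = (v x)^-1.
Proof.
have [->|x0] := eqVneq x 0; first by rewrite invr0 nonarch_abs0 invr0.
have vx_neq0 : v x != 0 by rewrite gt_eqF // nonarch_abs_gt0.
by apply: (mulfI vx_neq0); rewrite -(nonarch_absM v_abs) !divff ?nonarch_abs1.
Qed.

Lemma nonarch_absN x : v (- x) = v x.
Proof.
have /eqP : v (-1) ^+ 2 = 1 by rewrite -nonarch_absX sqrrN expr1n nonarch_abs1.
rewrite sqrf_eq1 => /orP[|] /eqP vN1.
  by rewrite -mulN1r (nonarch_absM v_abs) vN1 mul1r.
by have := nonarch_abs_ge0 v_abs (-1); rewrite vN1 ler0N1.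
Qed.

Lemma nonarch_absD_le x y r : v x <= r -> v y <= r -> v (x + y) <= r.
Proof.
by move=> xr yr; rewrite (le_trans (nonarch_absD v_abs x y))// ge_max xr yr.
Qed.

Lemma nonarch_abs_sum_le (I : Type) (s : seq I) (P : pred I) (F : I -> K) r :
  0 <= r -> (forall i, P i -> v (F i) <= r) -> v (\sum_(i <- s | P i) F i) <= r.
Proof.
move=> r0 Fr; apply: (big_ind (fun x => v x <= r)) => //.
  by rewrite nonarch_abs0.
by move=> x y; exact: nonarch_absD_le.
Qed.

Lemma nonarch_abs_nat_le1 k : v k%:R <= 1.
Proof.
elim: k => [|k IHk]; first by rewrite nonarch_abs0.
by rewrite -natr1 nonarch_absD_le// nonarch_abs1.
Qed.

(** Isosceles principle: were [|x| < |y|], both terms of [y = (y - x) + x] would be smaller than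
    [y]. *)
Lemma nonarch_abs_near x y : v (x - y) < v y -> v x = v y.
Proof.
move=> xy; have vyx : v (y - x) < v y by rewrite -opprB nonarch_absN.
have xley : v x <= v y by rewrite -(subrK y x) nonarch_absD_le // ltW.
apply/eqP; rewrite eq_le xley leNgt; apply/negP => xlty.
have := nonarch_absD v_abs (y - x) x.
by rewrite subrK leNgt gt_max vyx xlty.
Qed.

(** * The max norm on matrices *)

Lemma mxnorm_ge0 m n (M : 'M[K]_(m, n)) : 0 <= mxnorm v M.
Proof.
apply: (big_ind (fun x : R => 0 <= x)) => // [x y x0 y0|i _].
  by rewrite le_max x0.
by apply: (big_ind (fun x : R => 0 <= x)) => // [x y x0 y0|j _];
  [rewrite le_max x0|exact: nonarch_abs_ge0].
Qed.

Lemma le_mxnorm m n (M : 'M[K]_(m, n)) i j : v (M i j) <= mxnorm v M.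
Proof.
apply: le_trans (le_bigmax 0 (fun i => \big[Num.max/0]_j v (M i j)) i).
exact: (le_bigmax 0 (fun j => v (M i j)) j).
Qed.

Lemma mxnorm_leP m n (M : 'M[K]_(m, n)) r : 0 <= r ->
  (mxnorm v M <= r) <-> (forall i j, v (M i j) <= r).
Proof.
move=> r0; split=> [Mr i j|Mr]; first exact: le_trans (le_mxnorm M i j) Mr.
by apply: bigmax_le => // i _; apply: bigmax_le.
Qed.

Lemma mxnorm_tr m n (M : 'M[K]_(m, n)) : mxnorm v M^T = mxnorm v M.
Proof.
apply/eqP; rewrite eq_le; apply/andP.
by split; apply/mxnorm_leP; rewrite ?mxnorm_ge0// => i j;
  [rewrite mxE|have <- : M^T j i = M i j by rewrite mxE]; exact: le_mxnorm.
Qed.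

Lemma mxnorm_gt0 m n (M : 'M[K]_(m, n)) : (0 < mxnorm v M) = (M != 0).
Proof.
rewrite lt_neqAle mxnorm_ge0 andbT eq_sym; congr (~~ _).
apply/eqP/eqP => [M0|->].
  apply/matrixP => i j; rewrite mxE; apply/(nonarch_abs_eq0 v_abs)/eqP.
  by rewrite eq_le (nonarch_abs_ge0 v_abs) -M0 le_mxnorm.
apply/eqP; rewrite eq_le mxnorm_ge0 andbT.
by apply/mxnorm_leP => // i j; rewrite mxE nonarch_abs0.
Qed.

Lemma mxnormD_le m n (M N : 'M[K]_(m, n)) r :
  mxnorm v M <= r -> mxnorm v N <= r -> mxnorm v (M + N) <= r.
Proof.
move=> Mr Nr; apply/mxnorm_leP => [|i j].
  exact: le_trans (mxnorm_ge0 M) Mr.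
rewrite mxE nonarch_absD_le//; [apply: le_trans Mr|apply: le_trans Nr];
  exact: le_mxnorm.
Qed.

Lemma mxnormZ_le m n (a : K) (M : 'M[K]_(m, n)) :
  mxnorm v (a *: M) <= v a * mxnorm v M.
Proof.
have a0 := nonarch_abs_ge0 v_abs a.
apply/mxnorm_leP => [|i j]; first by rewrite mulr_ge0 ?mxnorm_ge0.
by rewrite mxE (nonarch_absM v_abs) ler_wpM2l ?le_mxnorm.
Qed.

Lemma mxnormZ m n (a : K) (M : 'M[K]_(m, n)) :
  mxnorm v (a *: M) = v a * mxnorm v M.
Proof.
apply/eqP; rewrite eq_le mxnormZ_le /=.
have [->|a0] := eqVneq a 0; first by rewrite nonarch_abs0 mul0r mxnorm_ge0.
rewrite -ler_pdivlMl ?nonarch_abs_gt0// -nonarch_absV.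
by rewrite -{1}(scalerK a0 M) mxnormZ_le.
Qed.

Lemma mxnormN m n (M : 'M[K]_(m, n)) : mxnorm v (- M) = mxnorm v M.
Proof. by rewrite -scaleN1r mxnormZ nonarch_absN nonarch_abs1 mul1r. Qed.

Lemma mxnormB_le m n (M N : 'M[K]_(m, n)) r :
  mxnorm v M <= r -> mxnorm v N <= r -> mxnorm v (M - N) <= r.
Proof. by move=> Mr Nr; rewrite mxnormD_le// mxnormN. Qed.

(** No dimension factor appears: an ultrametric sum is bounded by its largest term. *)
Lemma mxnormM_le m n p (M : 'M[K]_(m, n)) (N : 'M[K]_(n, p)) :
  mxnorm v (M *m N) <= mxnorm v M * mxnorm v N.
Proof.
have MN0 : 0 <= mxnorm v M * mxnorm v N by rewrite mulr_ge0 ?mxnorm_ge0.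
apply/mxnorm_leP => // i j; rewrite mxE nonarch_abs_sum_le// => k _.
rewrite (nonarch_absM v_abs) ler_pM ?le_mxnorm//; exact: nonarch_abs_ge0.
Qed.

Lemma mxnorm_ones_le1 m n : mxnorm v (const_mx 1 : 'M[K]_(m, n)) <= 1.
Proof. by apply/mxnorm_leP => // i j; rewrite mxE nonarch_abs1. Qed.

Lemma mxnorm_near_ones_le1 m n (M : 'M[K]_(m, n)) d : d <= 1 ->
  mxnorm v (M - const_mx 1) <= d -> mxnorm v M <= 1.
Proof.
move=> d1 Md; rewrite -(subrK (const_mx 1) M) mxnormD_le ?mxnorm_ones_le1//.
exact: le_trans d1.
Qed.

Lemma mxnorm_geometric_eq0 m n (M : 'M[K]_(m, n)) c r : 0 <= r < 1 ->
  (forall k, mxnorm v M <= c * r ^+ k) -> M = 0.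
Proof.
move=> r01 Mr; apply: contrapT => /eqP; rewrite -mxnorm_gt0.
by move=> /(exists_geometric_lt c r01)[N]; rewrite ltNge Mr.
Qed.

(** The limit is built entry by entry from completeness of [K]. By the ultrametric inequality the
    tail obeys the bound of its first step, with no factor [1 / (1 - r)]. *)
Lemma mx_geometric_limit m n (u : nat -> 'M[K]_(m, n)) c r :
    abs_complete v -> 0 <= c -> 0 <= r < 1 ->
    (forall k, mxnorm v (u k.+1 - u k) <= c * r ^+ k) ->
  exists a : 'M[K]_(m, n), forall k, mxnorm v (u k - a) <= c * r ^+ k.
Proof.
move=> v_complete c0 r01 u_step; have /andP[r0 /ltW r1] := r01.
have cr0 k : 0 <= c * r ^+ k by rewrite mulr_ge0 ?exprn_ge0.
have u_far p k : mxnorm v (u (k + p)%N - u k) <= c * r ^+ k.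
  elim: p => [|p IHp].
    by rewrite addn0 subrr; apply/mxnorm_leP => // i j; rewrite mxE nonarch_abs0.
  rewrite addnS -(subrK (u (k + p)%N) (u _.+1)) -addrA mxnormD_le//.
  by apply: le_trans (u_step _) _; rewrite ler_wpM2l// ler_wiXn2l ?leq_addr.
have entry_cvg i j : exists a, forall k, v (u k i j - a) <= c * r ^+ k.
  have cauchy : abs_cauchy v (fun k => u k i j).
    move=> e /(exists_geometric_lt c r01)[N crNe]; exists N => p q Np Nq.
    apply: le_lt_trans crNe.
    have far k : (N <= k)%N -> v (u k i j - u N i j) <= c * r ^+ N.
      move=> Nk; have := le_trans (le_mxnorm _ i j) (u_far (k - N)%N N).
      by rewrite subnKC// !mxE.
    rewrite -(subrK (u N i j) (u p i j)) -addrA nonarch_absD_le ?far//.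
    by rewrite -opprB nonarch_absN far.
  have [a ua] := v_complete _ cauchy; exists a => k.
  (* If [|u_k - a|] exceeded [c r ^ k], a later term would lie closer to [a] than [u_k] does, and
     both parts of [u_k - a] split at that term would be smaller than the whole. *)
  rewrite leNgt; apply/negP => rk.
  have rk0 : 0 < v (u k i j - a) by apply: le_lt_trans rk.
  move/cvgr0Pnorm_lt : ua => /(_ _ rk0) [N _ /(_ (k + N)%N (leq_addl _ _))] /=.
  rewrite ger0_norm ?(nonarch_abs_ge0 v_abs)// => near.
  have := nonarch_absD v_abs (u k i j - u (k + N)%N i j) (u (k + N)%N i j - a).
  rewrite addrA subrK leNgt gt_max near andbT; apply/negP/negPn.
  apply: le_lt_trans rk; rewrite -opprB nonarch_absN.
  by have := le_trans (le_mxnorm _ i j) (u_far N k); rewrite !mxE.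
have [a ua] := choice (fun ij => entry_cvg ij.1 ij.2).
exists (\matrix_(i, j) a (i, j)) => k.
by apply/mxnorm_leP => // i j; rewrite !mxE; exact: (ua (i, j)).
Qed.

(** * Matrices and vectors close to all-ones *)

(** Each [w_i x_i] is within [d] of 1, because [|w_i| <= 1]. With [w] all ones this estimates an
    entry sum; with a left and a right eigenvector and [d < |n|] it gives [w x <> 0]. *)
Lemma mul_near_ones n (w : 'rV[K]_n) (x : 'cV[K]_n) d : d <= 1 ->
    mxnorm v (w - const_mx 1) <= d -> mxnorm v (x - const_mx 1) <= d ->
  v ((w *m x) 0 0 - n%:R) <= d.
Proof.
move=> d1 wd xd; have -> : n%:R = \sum_(i < n) (1 : K).
  by rewrite sumr_const card_ord.
rewrite mxE -sumrB; have d0 := le_trans (mxnorm_ge0 _) wd.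
apply: nonarch_abs_sum_le => // i _.
have -> : w 0 i * x i 0 - 1 = w 0 i * (x i 0 - 1) + (w 0 i - 1) by ring.
have xi : v (x i 0 - 1) <= d.
  by have := le_trans (le_mxnorm _ i 0) xd; rewrite !mxE.
have wi : v (w 0 i - 1) <= d.
  by have := le_trans (le_mxnorm _ 0 i) wd; rewrite !mxE.
apply: nonarch_absD_le => //; rewrite (nonarch_absM v_abs) -(mul1r d).
rewrite ler_pM ?(nonarch_abs_ge0 v_abs)//.
exact: le_trans (le_mxnorm _ _ _) (mxnorm_near_ones_le1 d1 wd).
Qed.

(** The number of rows is arbitrary so that the bound serves both single eigenvectors and, through
    powers, the matrix [1 - P]. *)
Lemma near_ones_contraction m n (A : 'M[K]_n) (x : 'cV[K]_n) (u : 'M[K]_(m, n)) d :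
    mxnorm v (A - const_mx 1) <= d -> mxnorm v (x - const_mx 1) <= d ->
  u *m x = 0 -> mxnorm v (u *m A) <= d * mxnorm v u.
Proof.
move=> Ad xd ux; have d0 := le_trans (mxnorm_ge0 _) Ad.
have -> : u *m A = u *m (A - const_mx 1) -
    u *m (x - const_mx 1) *m (const_mx 1 : 'rV_n).
  rewrite !mulmxBr ux sub0r mulNmx opprK -mulmxA.
  have -> : (const_mx 1 : 'cV[K]_n) *m (const_mx 1 : 'rV_n) = const_mx 1.
    by apply/matrixP => i j; rewrite !mxE big_ord1 !mxE mulr1.
  by rewrite subrK.
apply: mxnormB_le; rewrite mulrC.
  by apply: le_trans (mxnormM_le _ _) _; rewrite ler_wpM2l ?mxnorm_ge0.
apply: le_trans (mxnormM_le _ _) _; rewrite -[leRHS]mulr1.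
rewrite ler_pM ?mxnorm_ge0 ?mxnorm_ones_le1//.
by apply: le_trans (mxnormM_le _ _) _; rewrite ler_wpM2l ?mxnorm_ge0.
Qed.

(** Serves over [K], for [A] and for its transpose, and over the completed algebraic closure. *)
Lemma near_ones_eigenvalue_le n (A : 'M[K]_n) (x : 'cV[K]_n) (u : 'rV[K]_n) a d :
    mxnorm v (A - const_mx 1) <= d -> mxnorm v (x - const_mx 1) <= d ->
  u *m x = 0 -> u *m A = a *: u -> u != 0 -> v a <= d.
Proof.
move=> Ad xd ux uA u0; rewrite -(ler_pM2r (x := mxnorm v u)) ?mxnorm_gt0//.
by rewrite -mxnormZ -uA; exact: near_ones_contraction Ad xd ux.
Qed.

(** The condition [u x = 0] survives multiplication by [A], as [u A x = a u x], so the contraction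
    can be iterated. *)
Lemma near_ones_power_le m n (A : 'M[K]_n) (x : 'cV[K]_n) (u : 'M[K]_(m, n)) a d k :
    mxnorm v (A - const_mx 1) <= d -> mxnorm v (x - const_mx 1) <= d ->
    A *m x = a *: x -> u *m x = 0 ->
  mxnorm v (u *m (a^-1 *: A) ^+ k) <= mxnorm v u * (d / v a) ^+ k.
Proof.
move=> Ad xd Ax; have d0 := le_trans (mxnorm_ge0 _) Ad.
have da0 : 0 <= d / v a by rewrite divr_ge0 ?(nonarch_abs_ge0 v_abs).
elim: k u => [|k IHk] u ux; first by rewrite !expr0 mulmx1 mulr1.
rewrite exprS -mulmxE mulmxA; apply: le_trans (IHk _ _) _.
  by rewrite -scalemxAr -scalemxAl -mulmxA Ax -scalemxAr ux !scaler0.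
rewrite exprS mulrA ler_wpM2r ?exprn_ge0//.
rewrite -scalemxAr mxnormZ nonarch_absV mulrC [leRHS]mulrC mulrAC.
rewrite ler_wpM2r ?invr_ge0 ?(nonarch_abs_ge0 v_abs)//.
exact: near_ones_contraction Ad xd ux.
Qed.

(** The eigenvalue is given as the entry sum of [x], so that [mul_near_ones] locates it near [n]. *)
Lemma near_ones_eigenvector n (A : 'M[K]_n) d :
    abs_complete v -> 0 <= d < v n%:R ->
    mxnorm v (A - const_mx 1) <= d * v n%:R ->
  exists2 x : 'cV[K]_n, A *m x = (const_mx 1 *m x : 'M[K]_1) 0 0 *: x
    & mxnorm v (x - const_mx 1) <= d.
Proof.
move=> v_complete; set q := v n%:R => /andP[d0 dq] Ad.
have q0 : 0 < q by exact: le_lt_trans dq.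
have q1 : q <= 1 := nonarch_abs_nat_le1 n.
have d1 : d <= 1 by rewrite (le_trans (ltW dq)).
pose s (y : 'cV[K]_n) := (const_mx 1 *m y : 'M[K]_1) 0 0.
pose E : 'M[K]_n := A - const_mx 1.
pose T (y : 'cV[K]_n) := const_mx 1 + (s y)^-1 *: (E *m y).
have v_s y : mxnorm v (y - const_mx 1) <= d -> v (s y) = q.
  move=> yd; apply: nonarch_abs_near; apply: le_lt_trans dq.
  apply: mul_near_ones => //; rewrite subrr.
  by apply/mxnorm_leP => // i j; rewrite mxE nonarch_abs0.
have s_neq0 y : mxnorm v (y - const_mx 1) <= d -> s y != 0.
  by move=> yd; rewrite -nonarch_abs_gt0 v_s.
have T_near y : mxnorm v (y - const_mx 1) <= d -> mxnorm v (T y - const_mx 1) <= d.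
  move=> yd; rewrite /T addrC addKr mxnormZ nonarch_absV v_s//.
  rewrite ler_pdivrMl// mulrC (le_trans (mxnormM_le _ _))//.
  rewrite -[leRHS]mulr1 ler_pM ?mxnorm_ge0//.
  exact: mxnorm_near_ones_le1 yd.
(* The ratio comes from the second term of [T y - T z] below: [|E z| <= d q] is divided by
   [|s y| |s z| = q ^ 2]. The first term is bounded by [d |y - z|], which is no larger since
   [q <= 1]. *)
pose r := d / q.
have r01 : 0 <= r < 1 by rewrite divr_ge0 ?(ltW q0)//= ltr_pdivrMr ?mul1r.
have T_contr y z : mxnorm v (y - const_mx 1) <= d ->
    mxnorm v (z - const_mx 1) <= d ->
    mxnorm v (T y - T z) <= r * mxnorm v (y - z).
  move=> yd zd; have yz0 := mxnorm_ge0 (y - z).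
  have -> : T y - T z = (s y)^-1 *: (E *m (y - z)) -
      ((s y)^-1 * (s z)^-1 * s (y - z)) *: (E *m z).
    have -> : s (y - z) = s y - s z by rewrite /s mulmxBr !mxE.
    have -> : (s y)^-1 * (s z)^-1 * (s y - s z) = (s z)^-1 - (s y)^-1.
      by field; rewrite !s_neq0.
    rewrite /T mulmxBr; move: (E *m y) (E *m z) => Ey Ez.
    by apply/matrixP => i j; rewrite !mxE; ring.
  apply: mxnormB_le; rewrite mxnormZ ?(nonarch_absM v_abs) !nonarch_absV (v_s _ yd)
      ?(v_s _ zd).
    rewrite ler_pdivrMl// mulrA (_ : q * r = d);
      last by rewrite mulrC divfK ?gt_eqF.
    rewrite (le_trans (mxnormM_le _ _))// ler_wpM2r// (le_trans Ad)//.
    by rewrite -[leRHS]mulr1 ler_wpM2l.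
  have Ez_le : mxnorm v (E *m z) <= d * q.
    rewrite (le_trans (mxnormM_le _ _))// -[leRHS]mulr1.
    by rewrite ler_pM ?mxnorm_ge0// (mxnorm_near_ones_le1 d1).
  have s_le : v (s (y - z)) <= mxnorm v (y - z).
    apply: le_trans (le_mxnorm _ 0 0) _; apply: le_trans (mxnormM_le _ _) _.
    by rewrite -[leRHS]mul1r ler_wpM2r ?mxnorm_ones_le1.
  have -> : q^-1 / q * v (s (y - z)) * mxnorm v (E *m z) =
      v (s (y - z)) * mxnorm v (E *m z) / (q * q) by field; rewrite gt_eqF.
  rewrite ler_pdivrMr ?mulr_gt0//.
  have -> : r * mxnorm v (y - z) * (q * q) = mxnorm v (y - z) * (d * q).
    by rewrite /r; field; rewrite gt_eqF.
  by rewrite ler_pM ?mxnorm_ge0 ?(nonarch_abs_ge0 v_abs).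
pose x k := iter k T (const_mx 1).
have x_near k : mxnorm v (x k - const_mx 1) <= d.
  elim: k => [|k IHk]; last exact: T_near.
  by rewrite subrr; apply/mxnorm_leP => // i j; rewrite mxE nonarch_abs0.
have x_step k : mxnorm v (x k.+1 - x k) <= d * r ^+ k.
  elim: k => [|k IHk]; first by rewrite expr0 mulr1 x_near.
  apply: le_trans (T_contr _ _ (x_near k.+1) (x_near k)) _.
  by rewrite exprS mulrCA ler_wpM2l//; case/andP: r01.
have [a xa] := mx_geometric_limit v_complete d0 r01 x_step.
have ad : mxnorm v (a - const_mx 1) <= d.
  by rewrite -opprB mxnormN; have := xa 0%N; rewrite expr0 mulr1.
exists a => //.
(* Passing through [x k.+1 = T (x k)] bounds the difference by [d r ^ k] for every [k]. *)
have Ta : T a - a = 0.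
  apply: (mxnorm_geometric_eq0 (c := d) r01) => k.
  rewrite -(subrK (x k.+1) (T a)) -addrA mxnormD_le//.
    rewrite -opprB mxnormN (le_trans (T_contr _ _ (x_near k) ad))//.
    case/andP : r01 => r0 r1; rewrite -[leRHS]mul1r.
    by rewrite ler_pM ?mxnorm_ge0 ?(ltW r1).
  case/andP : r01 => r0 r1.
  by apply: le_trans (xa _) _; rewrite ler_wpM2l// ler_wiXn2l ?(ltW r1).
have aT : a = T a by apply/eqP; rewrite eq_sym -subr_eq0 Ta.
(* Multiplying [a = T a] by [s a] gives [s(a) a = s(a) 1 + (A - J) a], and [s(a) 1 = J a]. *)
rewrite -/(s a) [in X in _ *: X]aT /T scalerDr scalerA divff ?s_neq0//.
rewrite scale1r mulmxBl.
rewrite addrCA -[LHS]addr0; congr (_ + _); apply/esym/eqP; rewrite subr_eq0.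
apply/eqP/matrixP => i j; rewrite ord1 /s !mxE mulr1.
by apply: eq_bigr => k _; rewrite !mxE.
Qed.


End NonarchAbs.

(** * Uniformizing parameters and the order function *)

Section Uniformizer.
Variables (R : realType) (K : fieldType) (v : K -> R) (pi : K).
Hypotheses (v_abs : nonarch_abs v) (v_nontrivial : nontrivial_abs v).
Hypothesis pi_unif : uniformizer v pi.

(** The open unit ball is a proper ideal containing [pi R], so maximality makes them equal. If
    [|pi| = 1], then [pi R] would be all of [R]; if [|pi| = 0], the open ball would be zero, whereas
    a nontrivial value puts some nonzero [x] or its inverse there. *)
Lemma uniformizer_abs :
  0 < v pi < 1 /\ forall y, v y < 1 -> v y <= v pi.
Proof.
have [[_ piR_neq piR_max] pi_le1] := conj ((pi_unif.2 _).2 erefl) pi_unif.1.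
have pi_lt1 : v pi < 1.
  rewrite lt_neqAle pi_le1 andbT; apply/negP => /eqP vpi1; apply: piR_neq.
  have pi0 : pi != 0 by rewrite -(nonarch_abs_gt0 v_abs) vpi1.
  apply/seteqP; split=> [_ [a a1 <-]|x x1]; rewrite /int_ring /=.
    by rewrite (nonarch_absM v_abs) vpi1 mul1r.
  exists (x / pi); last by rewrite mulrC divfK.
  by rewrite /int_ring /= (nonarch_absM v_abs) nonarch_absV// vpi1 divr1.
have J_eq : [set x | v x < 1] = [set pi * a | a in int_ring v].
  have [||//|J_eq] := piR_max [set x | v x < 1].
  - split=> [x /ltW//||x y x1 y1|a x a1 x1] /=.
    + by rewrite nonarch_abs0.
    + by rewrite (le_lt_trans (nonarch_absD v_abs _ _))// gt_max x1.
    + rewrite (nonarch_absM v_abs) (le_lt_trans _ x1)// -[leRHS]mul1r.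
      by rewrite ler_wpM2r ?(nonarch_abs_ge0 v_abs).
  - move=> _ [a a1 <-] /=; rewrite (nonarch_absM v_abs) (le_lt_trans _ pi_lt1)//.
    by rewrite -[leRHS]mulr1 ler_wpM2l ?(nonarch_abs_ge0 v_abs).
  - have : int_ring v 1 by rewrite /int_ring /= nonarch_abs1.
    by rewrite -J_eq /= nonarch_abs1// ltxx.
have small_le y : v y < 1 -> v y <= v pi.
  move=> y1; have : [set x | v x < 1] y by [].
  rewrite J_eq => -[a a1 <-]; rewrite (nonarch_absM v_abs) -[leRHS]mulr1.
  by rewrite ler_wpM2l ?(nonarch_abs_ge0 v_abs).
split=> //; rewrite pi_lt1 andbT lt_neqAle (nonarch_abs_ge0 v_abs) andbT.
apply/negP => /eqP vpi0; have small0 y : v y < 1 -> y = 0.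
  move=> /small_le; rewrite -vpi0 => y0; apply/(nonarch_abs_eq0 v_abs)/eqP.
  by rewrite eq_le y0 (nonarch_abs_ge0 v_abs).
have [x x0] := v_nontrivial; rewrite neq_lt => /orP[/small0/eqP|x1].
  by rewrite (negPf x0).
have /small0/eqP : v x^-1 < 1.
  by rewrite nonarch_absV// invf_lt1 ?(lt_trans ltr01 x1).
by rewrite invr_eq0 (negPf x0).
Qed.

(** Take the least exponent with [|pi| ^ m <= |x|]. If it is [m + 1], then [|x / pi ^ m| < 1], hence
    this value is at most [|pi|]. *)
Lemma int_abs_uniformizerX x : x != 0 -> v x <= 1 ->
  exists m : nat, v x = v pi ^+ m.
Proof.
have [/andP[pi0 pi1] small_le] := uniformizer_abs; move=> x0 x1.
have vx0 : 0 < v x by rewrite nonarch_abs_gt0.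
have pow_le : exists m, v pi ^+ m <= v x.
  have [||m] := @exists_geometric_lt _ 1 (v pi) (v x) => //.
    by rewrite ltW.
  by rewrite mul1r => /ltW; exists m.
case: (ex_minnP pow_le) => -[|m] pm_le pm_min.
  by exists 0%N; apply/eqP; rewrite eq_le expr0 x1.
exists m.+1; apply/eqP; rewrite eq_le pm_le andbT.
have pm0 : 0 < v pi ^+ m by rewrite exprn_gt0.
have x_lt : v x < v pi ^+ m.
  by rewrite ltNge; apply/negP => /pm_min; rewrite ltnn.
have vxpm : v (x / pi ^+ m) = v x / v pi ^+ m.
  by rewrite (nonarch_absM v_abs) nonarch_absV// nonarch_absX.
have := small_le (x / pi ^+ m).
rewrite vxpm ltr_pdivrMr// mul1r => /(_ x_lt).
by rewrite ler_pdivrMr// exprS.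
Qed.

(** Turns [l > 2 ord(n)] into [|pi| ^ l < |n| ^ 2]. The case [x = 0] is excluded because its order
    is infinite. *)
Lemma ord_unif_lt (x : K) (l : nat) : v x <= 1 ->
    ((2 : int)%:E * ord_unif v pi x < (l%:Z)%:E)%E ->
  x != 0 /\ v pi ^+ l < v x * v x.
Proof.
have [/andP[pi0 pi1] _] := uniformizer_abs; move=> x1.
rewrite /ord_unif; have [_|x0] := eqVneq x 0; first by rewrite gt0_muley.
have [m vx] := int_abs_uniformizerX x0 x1.
(* Powers of [|pi|], which lies strictly between 0 and 1, determine their exponent, so [xget] can
   only return [m]. *)
have -> : xget 0 [set k : int | v x = v pi ^ k] = m.
  have : [set k : int | v x = v pi ^ k] m by rewrite /= vx exprnP.
  case: xgetP => [k _ /= vxk _|none /none//].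
  by apply: (ieexprIz pi0); rewrite ?lt_eqF// -vxk vx exprnP.
rewrite -EFinM lte_fin => ml; split=> //.
by rewrite vx -exprD ltr_iXn2l// addnn -mul2n.
Qed.

End Uniformizer.

(** * The dominant eigenvalue and the limit projection *)

Theorem theorem6 (R : realType) (K : fieldType) (v : K -> R)
    (v_abs : nonarch_abs v) (v_complete : abs_complete v)
    (v_nontrivial : nontrivial_abs v) (v_discrete : discrete_value_group v)
    (pi : K) (pi_unif : uniformizer v pi)
    (n : nat) (n_gt0 : (0 < n)%N)
    (l : nat) (l_gt0 : (0 < l)%N)
    (l_gt : ((2 : int)%:E * ord_unif v pi n%:R < (l%:Z)%:E)%E)
    (A : 'M[K]_n)
    (A_disc : forall i j : 'I_n, A i j \in disc v 1 (v pi ^+ l)) :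
  exists lmax : K,
    [/\ [/\ simple_eigenvalue A lmax,
            forall (C : completed_alg_closure v) (lam : cac_field C),
              eigenvalue (map_mx (cac_emb C) A) lam ->
              lam != cac_emb C lmax ->
              cac_abs lam < cac_abs (cac_emb C lmax)
          & v lmax = v n%:R],
        lmax \in disc v n%:R (v pi ^+ l / v n%:R),
        exists x : 'cV[K]_n,
          [/\ x != 0, col_eigenspace A lmax x
            & forall i : 'I_n, x i 0 \in disc v 1 (v pi ^+ l / v n%:R)]
      & exists P : 'M[K]_n,
          mx_cvg v (fun k => (lmax^-1 *: A) ^+ k) P /\
          projection_onto P (col_eigenspace A lmax)].
Proof.
have q1 : v n%:R <= 1 := nonarch_abs_nat_le1 v_abs n.
have [n0] := ord_unif_lt v_abs v_nontrivial pi_unif q1 l_gt.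
set q := v n%:R in q1 *; have q0 : 0 < q by rewrite nonarch_abs_gt0.
set d := v pi ^+ l / q => eps_lt.
(* This is [|pi| ^ l < q ^ 2] divided by [q]. *)
have dq : d < q by rewrite ltr_pdivrMr.
have d0 : 0 <= d by rewrite divr_ge0 ?exprn_ge0 ?(nonarch_abs_ge0 v_abs)// ltW.
have d1 : d <= 1 by rewrite (le_trans (ltW dq)).
have Adq : mxnorm v (A - const_mx 1) <= d * q.
  rewrite divfK ?gt_eqF//; apply/mxnorm_leP => [|i j].
    by rewrite exprn_ge0 ?(nonarch_abs_ge0 v_abs).
  by rewrite !mxE; exact: set_mem (A_disc i j).
have Ad : mxnorm v (A - const_mx 1) <= d.
  by apply: le_trans Adq _; rewrite -[leRHS]mulr1 ler_wpM2l.
have trA (M : 'M[K]_n) : mxnorm v (M^T - const_mx 1) = mxnorm v (M - const_mx 1).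
  by rewrite -(mxnorm_tr v_abs (M - _)) linearB /= trmx_const.
have dq0 : 0 <= d < q by rewrite d0.
have [x Ax xd] := near_ones_eigenvector v_abs v_complete dq0 Adq.
set a := (_ *m x : 'M[K]_1) 0 0 in Ax.
have [y Ay yd] : exists2 y : 'cV[K]_n,
    A^T *m y = (const_mx 1 *m y : 'M[K]_1) 0 0 *: y
    & mxnorm v (y - const_mx 1) <= d.
  by apply: near_ones_eigenvector; rewrite ?trA.
set b := (_ *m y : 'M[K]_1) 0 0 in Ay; pose w := y^T.
have wd : mxnorm v (w - const_mx 1) <= d.
  by rewrite -(mxnorm_tr v_abs) linearB /= trmxK trmx_const.
have ad : v (a - n%:R) <= d.
  apply: mul_near_ones => //; rewrite subrr.
  by apply/mxnorm_leP => // i j; rewrite mxE nonarch_abs0.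
have va : v a = q by apply: nonarch_abs_near => //; exact: le_lt_trans ad dq.
have a0 : a != 0 by rewrite -(nonarch_abs_gt0 v_abs) va.
have wx0 : (w *m x) 0 0 != 0.
  rewrite -(nonarch_abs_gt0 v_abs) (nonarch_abs_near v_abs (y := n%:R))//.
  exact: le_lt_trans (mul_near_ones v_abs d1 wd xd) dq.
have wAb : w *m A = b *: w by rewrite -[A]trmxK -trmx_mul Ay linearZ.
(* Computing [w A x] in two ways gives [b (w x) = a (w x)]. *)
have ba : b = a.
  have : w *m A *m x = w *m (A *m x) by rewrite mulmxA.
  rewrite wAb Ax -scalemxAl -scalemxAr => /matrixP /(_ 0 0).
  by rewrite [LHS]mxE [RHS]mxE => /(mulIf wx0).
rewrite ba in Ay wAb; move=> {b ba}.
have x0 : x != 0.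
  by apply: contra_neq wx0 => ->; rewrite mulmx0 mxE.
have no_left (u : 'rV[K]_n) : u *m x = 0 -> u *m A = a *: u -> u = 0.
  move=> ux uA; apply: contrapT => /eqP u0.
  by have := near_ones_eigenvalue_le v_abs Ad xd ux uA u0; rewrite va leNgt dq.
(* Transposed, this is the eigenvalue bound for [A^T], with [y] as the eigenvector near all-ones. *)
have no_right (u : 'cV[K]_n) : w *m u = 0 -> A *m u = a *: u -> u = 0.
  move=> wu Au; apply: contrapT => /eqP u0.
  have ATd : mxnorm v (A^T - const_mx 1) <= d by rewrite trA.
  have := @near_ones_eigenvalue_le _ _ _ v_abs _ _ y u^T a _ ATd yd.
  rewrite -[y]trmxK -!trmx_mul wu Au trmx0 linearZ trmx_eq0 va.
  move=> /(_ erefl erefl u0).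
  by rewrite leNgt dq.
exists a; split; [split| | |].
- split; last exact: mup_char_poly_deflation Ax wx0 a0 no_left.
  (* [eigenvalue] refers to row vectors, so the witness is the left eigenvector. *)
  apply/eigenvalueP; exists w => //.
  by apply: contra_neq wx0 => ->; rewrite mul0mx mxE.
- move=> C lam /eigenvalueP[u uA u0] lam_neq.
  have emb_norm m p (M : 'M[K]_(m, p)) :
      mxnorm (@cac_abs _ _ _ C) (map_mx (cac_emb C) M) = mxnorm v M.
    apply: eq_bigr => i _; apply: eq_bigr => j _; rewrite mxE.
    exact: cac_extends.
  (* [f] is [cac_emb C] as a bundled ring morphism, which the lemmas on [map_mx] require. *)
  pose f : {rmorphism K -> cac_field C} := cac_inj1 C \o cac_inj0 C.
  have emb_near m p (M : 'M[K]_(m, p)) :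
      mxnorm (@cac_abs _ _ _ C) (map_mx (cac_emb C) M - const_mx 1) =
      mxnorm v (M - const_mx 1).
    rewrite -emb_norm -[map_mx (cac_emb C) (_ - _)]/(map_mx f (_ - _)).
    by rewrite map_mxB map_const_mx /= !rmorph1.
  (* Otherwise [lam (u x) = u A x = a (u x)] would force [lam] to be the image of [a]. *)
  have ux : u *m map_mx (cac_emb C) x = 0.
    apply: contrapT => /eqP ux_neq0; move/eqP: lam_neq; apply.
    have : u *m map_mx f A *m map_mx f x = u *m (map_mx f A *m map_mx f x).
      by rewrite mulmxA.
    rewrite -map_mxM Ax map_mxZ uA -scalemxAl -scalemxAr => /eqP.
    by rewrite -subr_eq0 -scalerBl scaler_eq0 (negPf ux_neq0) orbF subr_eq0 => /eqP.
  rewrite [cac_abs (cac_emb _ _)]cac_extends va (le_lt_trans _ dq)//.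
  apply: (near_ones_eigenvalue_le (cac_nonarch C) _ _ ux uA u0);
    by rewrite emb_near.
- exact: va.
- exact: mem_set.
- exists x; split=> // i; apply/mem_set.
  by have := le_trans (le_mxnorm v _ i 0) xd; rewrite !mxE.
- pose P := eigenprojection x w; exists P; split.
    have P_pow k : P *m (a^-1 *: A) ^+ k = P.
      elim: k => [|k IHk]; first by rewrite expr0 mulmx1.
      rewrite exprSr -mulmxE mulmxA IHk -scalemxAr (eigenprojectionA _ wAb).
      by rewrite scalerA mulVf ?scale1r.
    have Px : (1%:M - P) *m x = 0.
      by rewrite mulmxBl mul1mx eigenprojection_eigenvector ?subrr.
    have r01 : `|d / q| < 1.
      have dq_ge0 : 0 <= d / q := divr_ge0 d0 (ltW q0).
      by rewrite ger0_norm// ltr_pdivrMr// mul1r.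
    apply: (@squeeze_cvgr _ _ _ _ (fun=> 0)
      (fun k => mxnorm v (1%:M - P) * (d / q) ^+ k)).
    + near=> k; rewrite mxnorm_ge0 //=.
      (* Since [P] absorbs powers of [A / a], the error is [1 - P] times such a power, and [1 - P]
         kills [x]. *)
      have -> : (a^-1 *: A) ^+ k - P = (1%:M - P) *m (a^-1 *: A) ^+ k.
        by rewrite mulmxBl mul1mx P_pow.
      rewrite -va; exact: near_ones_power_le Ad xd Ax Px.
    + exact: cvg_cst.
    + rewrite -[X in _ --> X](mulr0 (mxnorm v (1%:M - P))).
      by apply: cvgM (cvg_cst _) (cvg_expr _).
  split; first exact: eigenprojection_idem.
  apply/seteqP; split=> [_ [z _ <-]|z Az]; rewrite /col_eigenspace /=.
    by rewrite mulmxA (mulA_eigenprojection w Ax) scalemxAl.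
  (* For [A z = a z], the vector [z - P z] is killed by [w] and satisfies the same equation, hence
     vanishes. *)
  exists z => //; apply/eqP; rewrite eq_sym -subr_eq0; apply/eqP/no_right.
    by rewrite mulmxBr mulmxA eigenvector_eigenprojection ?subrr.
  by rewrite mulmxBr mulmxA (mulA_eigenprojection w Ax) Az scalerBr scalemxAl.
Unshelve. all: by end_near.
Qed.
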